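(* Suppose $T$ is a tree containing a vertex $v$ with at least $2$ children. If $\mathcal{X}$ is an infinite-dimensional discrete function space on $T$ that contains $\chi_w$ for some $w\in\mathrm{ch}(v)$, then the differentiation operator $D$ is not compact on $\mathcal{X}$.
   Context: A tree $T$ is a locally finite, connected, simply-connected graph, identified with its set of vertices. A vertex is terminal if it has a unique neighbor; all trees are assumed to be without terminal vertices (hence infinite) and rooted at a vertex $o$. For $v\neq o$, $v^-$ denotes the unique neighbor of $v$ lying on the path from $o$ to $v$; $v$ is called a child of $v^-$, and $\mathrm{ch}(v)$ is the set of all children of $v$. A function on $T$ is a complex-valued function on its vertices. The derivative of $f:T\to\mathbb{C}$ is $f'(v)=f(v)-f(v^-)$ for $v\neq o$ and $f'(o)=0$; the differentiation operator is $Df=f'$. The characteristic function $\chi_w$ is $\chi_w(u)=1$ if $u=w$ and $0$ otherwise. A functional Banach space on a set $\Omega$ is a Banach space of complex-valued functions on $\Omega$ with pointwise vector operations, such that $f(x)=g(x)$ for all $x\in\Omega$ implies $f=g$, $f(x)=f(y)$ for every $f$ in the space implies $x=y$, and for each $x\in\Omega$ the linear functional $f\mapsto f(x)$ is continuous. A discrete function space $\mathcal{X}$ on $T$ is a functional Banach space whose elements are functions on $T$, with norm $\|\cdot\|_{\mathcal{X}}$. $D$ is compact on $\mathcal{X}$ if it maps $\mathcal{X}$ into $\mathcal{X}$ and for every bounded sequence $\{x_n\}$ in $\mathcal{X}$ the sequence $\{Dx_n\}$ has a convergent subsequence in $\mathcal{X}$. *)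

(* Defs.v *)
(* The complex numbers are R[i] for an arbitrary R : realType; norms take values
   in R[i], where 0 <= x forces x to be real. *)
From HB Require Import structures.
From mathcomp Require Import all_boot all_order all_algebra.
From mathcomp Require Import complex.
From mathcomp Require Import all_classical all_reals all_analysis.

Set Implicit Arguments.
Unset Strict Implicit.
Unset Printing Implicit Defensive.

Import Order.TTheory GRing.Theory Num.Theory numFieldNormedType.Exports.

Local Open Scope classical_set_scope.
Local Open Scope ring_scope.

(* The vertex sequence of the path is x :: p. *)
Definition simple_path (V : eqType) (e : rel V) (x y : V) (p : seq V) : Prop :=
  [/\ path e x p, last x p = y & uniq (x :: p)].

Definition terminal (V : Type) (e : rel V) (v : V) : Prop := exists! u, e v u.

Record rootedTree := RootedTree {
  vertex :> choiceType;
  adj : rel vertex;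
  root_vertex : vertex;
  adj_sym : symmetric adj;
  adj_irr : irreflexive adj;
  adj_locally_finite : forall v, finite_set [set u | adj v u];
  adj_connected : forall u v, exists p, path adj u p /\ last u p = v;
  (* simply connected: no cycle with at least 3 distinct vertices *)
  adj_acyclic : forall c : seq vertex, (2 < size c)%N -> ~ ucycle adj c;
  no_terminal : forall v, ~ terminal adj v }.

Arguments adj {r} _ _.
Arguments root_vertex {r}.

Section Tree.
Variable T : rootedTree.
Implicit Types u v w : T.

(* v^-.  The parent of the root is the junk value [root_vertex]; hence the
   explicit exclusion of the root in [children] and [tree_deriv]. *)
Definition parent v : T :=
  xget root_vertex
    [set u | adj v u /\ exists2 p, simple_path adj root_vertex v p &
                                   u \in root_vertex :: p].

Definition children v : set T := [set w | w != root_vertex /\ parent w = v].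

Definition tree_deriv (C : zmodType) (f : T -> C) (v : T) : C :=
  if v == root_vertex then 0 else f v - f (parent v).

Definition chi (C : pzRingType) w (u : T) : C := if u == w then 1 else 0.

End Tree.

Arguments chi {T} C w u.

(* The elements are represented by an abstract complex Banach space together
   with an injective pointwise-linear evaluation [ev], so that the space is
   identified with its image, a linear subspace of Omega -> R[i]. *)
Record functionalBanachSpace (R : realType) (Omega : Type) :=
  FunctionalBanachSpace {
  carrier :> completeNormedModType R[i];
  ev : carrier -> Omega -> R[i];
  ev_add : forall f g x, ev (f + g) x = ev f x + ev g x;
  ev_scale : forall a f x, ev (a *: f) x = a * ev f x;
  ev_inj : forall f g, (forall x, ev f x = ev g x) -> f = g;
  ev_separates : forall x y, (forall f, ev f x = ev f y) -> x = y;
  ev_continuous : forall x, continuous (fun f => ev f x : R[i]^o) }.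

Arguments ev {R Omega} X f x : rename.

Definition discreteFunctionSpace (R : realType) (T : rootedTree) :=
  functionalBanachSpace R T.

Definition contains (R : realType) (Omega : Type)
    (X : functionalBanachSpace R Omega) (h : Omega -> R[i]) : Prop :=
  exists f : X, ev X f = h.

Definition finite_dimensional (K : pzRingType) (V : lmodType K) : Prop :=
  exists n (b : 'I_n -> V),
    forall x, exists c : 'I_n -> K, x = \sum_(i < n) c i *: b i.

(* An operator L on functions is compact on X when it restricts to a self-map S
   of X (unique, by [ev_inj]) that sends bounded sequences to sequences with a
   norm-convergent subsequence. *)
Definition compact_on (R : realType) (Omega : Type)
    (X : functionalBanachSpace R Omega)
    (L : (Omega -> R[i]) -> (Omega -> R[i])) : Prop :=
  exists2 S : X -> X, (forall f, ev X (S f) = L (ev X f)) &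
    forall x : nat -> X, bounded_fun x ->
      exists2 s : nat -> nat, increasing_seq s & cvgn (S \o x \o s).

(* Main.v *)
Require Import Defs.
From mathcomp Require Import all_boot all_order all_algebra.
From mathcomp Require Import complex.
From mathcomp Require Import all_classical all_reals all_analysis.

Import Order.TTheory GRing.Theory Num.Theory numFieldNormedType.Exports.

(** On any function of the space, [A = I - D] acts by composition with the
    parent map: [(A f) x] is [f (parent x)], and [f x] when [x] is the root.
    Hence every function in the range of [A] takes equal values at siblings,
    whereas the characteristic function [g] of [w] separates [w] from a sibling
    [w'].  So [A] is injective but not surjective, which the Fredholm
    alternative forbids when [D] is compact.

    The half of the Fredholm alternative at stake is proved directly, from the
    descending chain of the ranges of the powers of [A]
    ([no_compact_with_gaps]).  If consecutive subspaces of the chain lie at a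
    positive distance, the Riesz lemma gives unit vectors whose images under
    [I - A] are pairwise at distance at least 1/2, hence have no convergent
    subsequence.  The general theory obtains these positive distances from
    compactness, by showing that the ranges are closed; here they come from the
    tree.  As no vertex is terminal, every vertex has a child ([has_child]), so
    [w] and [w'] have descendants [y] and [y'], [n] generations below, where the
    values of [A^n f] are [f w] and [f w'].  The functional
    [h |-> h y - h y'] is continuous, vanishes on the range of [A^(n+1)] and
    equals 1 at [A^n g]: that point is away from that range. *)

Local Open Scope classical_set_scope.
Local Open Scope ring_scope.

(** * Parents and children in a tree *)

(** Shortening a walk that joins two distinct neighbors of [x] away from [x],
    then closing it through [x], would give a cycle. *)
Lemma walk_avoiding (T : rootedTree) (x a b : T) (p : seq T) :
  adj x a -> adj x b -> path adj a p -> last a p = b -> x \notin a :: p ->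
  a = b.
Proof.
move=> xa + ap ab; rewrite -{b}ab inE negb_or => + /andP[xna xnp].
case/shortenP: ap => -[//|c q] aq uq sub_qp xb.
exfalso; apply: (@adj_acyclic T [:: x, a, c & q]) => //.
rewrite /ucycle cons_uniq uq andbT; apply/andP; split.
  rewrite [cycle _ _]/= -[_ && _]/(path adj x (rcons (a :: c :: q) x)).
  by rewrite rcons_path /= xa /= in aq *; rewrite aq adj_sym.
by rewrite inE negb_or xna; apply/negP => /sub_qp; apply/negP.
Qed.

Definition reachable_avoiding {T : rootedTree} (x y z : T) : Prop :=
  exists p, [/\ path adj y p, last y p = z & x \notin y :: p].

(** Two walks from [y] that avoid [x] join [a] to [b] through [y], still
    avoiding [x].  This yields at once the uniqueness of the parent and, when
    there are two neighbors, the existence of one that is not the parent. *)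
Lemma neighbor_towards_unique {T : rootedTree} {x y a b : T} :
  adj x a -> adj x b -> reachable_avoiding x y a -> reachable_avoiding x y b ->
  a = b.
Proof.
move=> xa xb [p [yp pa xp]] [q [yq qb xq]].
apply: (@walk_avoiding _ x a b (rev (belast y p) ++ q)) => //.
- rewrite cat_path -pa rev_path (eq_path (e' := adj)); last first.
    by move=> ? ?; rewrite adj_sym.
  by rewrite yp /= -(last_cons y) -rev_rcons -lastI rev_cons last_rcons.
- rewrite last_cat -pa -qb; congr last.
  by rewrite -(last_cons y) -rev_rcons -lastI rev_cons last_rcons.
- rewrite -cat_cons -pa -rev_rcons -lastI mem_cat mem_rev (negPf xp) /=.
  by move: xq; rewrite inE negb_or => /andP[].
Qed.

Lemma simple_path_prefix {T : rootedTree} {x y z : T} {p : seq T} :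
  simple_path adj y x p -> z \in y :: p -> z != x -> reachable_avoiding x y z.
Proof.
move=> [yp <- uq] zp; case/splitPl: zp yp uq => q r qz.
rewrite cat_path => /andP[yq _]; rewrite last_cat qz -cat_cons cat_uniq.
move=> /and3P[_ /hasPn qr _] zx; exists q; split=> //; apply: qr.
by case: r zx => [|c r] /=; rewrite ?eqxx ?mem_last.
Qed.

(** A walk from the root to [u] that avoids [x] shortens to a simple path,
    which the edge from [u] to [x] prolongs: so [u] satisfies the condition
    that defines [parent x], and only one vertex can. *)
Lemma parent_eq {T : rootedTree} {x u : T} :
  adj u x -> reachable_avoiding x root_vertex u ->
  x != root_vertex /\ parent x = u.
Proof.
move=> ux xu; split.
  case: xu => p [_ _]; rewrite inE negb_or => /andP[]//.
rewrite /parent; case: xgetP => [z _ [xz [p pP zp]]|].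
  apply: (neighbor_towards_unique xz _ _ xu); first by rewrite adj_sym.
  apply: (simple_path_prefix pP zp).
  by apply: contraTneq xz => ->; rewrite adj_irr.
move=> /(_ u)[]; split; first by rewrite adj_sym.
case: xu => p [op pu xp].
case: (shortenP op) pu => q oq uq sub_qp qu.
exists (rcons q x); last by rewrite -rcons_cons mem_rcons inE -qu mem_last orbT.
split; first by rewrite rcons_path oq qu.
  by rewrite last_rcons.
rewrite -rcons_cons rcons_uniq uq andbT.
move: xp; rewrite !inE !negb_or => /andP[-> xp] /=.
by apply: contra xp; apply: sub_qp.
Qed.

(** Without a neighbor, [u] would be the only vertex; with a single one, it
    would be terminal.  Two neighbors cannot both lie on the simple path from
    the root to [u], and one that lies off it is a child. *)
Lemma has_child (T : rootedTree) (a b u : T) : a <> b -> exists x, children u x.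
Proof.
move=> ab.
have [c uc] : exists c, adj u c.
  apply: contrapT => no_nbr.
  suff all_u d : u = d by apply: ab; rewrite -(all_u a).
  have [[|c q] [/= + qd]] := adj_connected u d; first by [].
  by move=> /andP[uc _]; case: no_nbr; exists c.
have [d [ud cd]] : exists d, adj u d /\ c <> d.
  apply: contrapT => no_other; apply: (@no_terminal T u).
  exists c; split=> // d ud; apply: contrapT => cd.
  by apply: no_other; exists d.
have [p [op pu]] := adj_connected root_vertex u.
case/shortenP: op pu => q oq uq _ qu.
have nbr_neq e : adj u e -> e != u.
  by apply: contraTneq => ->; rewrite adj_irr.
have off_path e :
    adj u e -> e \notin root_vertex :: q -> exists x, children u x.
  by move=> ue eq; exists e; apply: parent_eq => //; exists q.
have [cq|] := boolP (c \in root_vertex :: q); last exact: off_path.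
have [dq|] := boolP (d \in root_vertex :: q); last exact: off_path.
case: cd; apply: (neighbor_towards_unique uc ud).
- by apply: (simple_path_prefix _ cq (nbr_neq _ uc)).
- by apply: (simple_path_prefix _ dq (nbr_neq _ ud)).
Qed.

(** * The Riesz lemma and descending chains of subspaces *)

Definition linear_subspace {K : pzRingType} {V : lmodType K} (U : set V) :=
  U 0 /\ forall a x y, U x -> U y -> U (a *: x + y).

(** The norm takes real values in the partially ordered field [R[i]]; the
    infimum of the distances is taken in [R], through the real part.  Its being
    positive is what allows the factor 2. *)
Lemma almost_nearest (R : realType) (V : normedModType R[i])
    (U : set V) (g : V) (eps : R[i]) :
  U 0 -> 0 < eps -> (forall z, U z -> eps <= `|g - z|) ->
  exists2 z, U z & forall z', U z' -> `|g - z| <= 2 * `|g - z'|.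
Proof.
move=> U0 eps_gt0 far.
pose dist z := complex.Re `|g - z|.
have distE z : `|g - z| = (dist z)%:C%C.
  by rewrite /dist RRe_real // ger0_real.
have epsE : eps = (complex.Re eps)%:C%C by rewrite RRe_real // gtr0_real.
have e_gt0 : 0 < complex.Re eps by rewrite epsE ltcR in eps_gt0.
pose E := dist @` U.
have lbE r : E r -> complex.Re eps <= r.
  by move=> [z Uz <-]; rewrite -lecR -epsE -distE far.
have E_inf : has_inf E by split; [exists (dist 0), 0 | exists (complex.Re eps)].
have inf_gt0 : 0 < inf E.
  by apply: (lt_le_trans e_gt0); apply: lb_le_inf; [case: E_inf|].
have [_ [z Uz <-] zlt] := inf_adherent inf_gt0 E_inf.
exists z => // z' Uz'; rewrite !distE -(rmorph_nat (real_complex R) 2) -rmorphM.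
rewrite lecR; apply: (le_trans (ltW zlt)).
rewrite mulr_natl -mulr2n lerMn2r /=; apply: ge_inf; first by case: E_inf.
by exists z'.
Qed.

(** Subtract from [g] an almost nearest point of [U] and normalize.  Closedness
    of [U] is replaced by the positive distance from the given [g]. *)
Lemma Riesz (R : realType) (V : normedModType R[i])
    (U W : set V) (g : V) (eps : R[i]) :
  linear_subspace U -> linear_subspace W -> U `<=` W -> W g ->
  0 < eps -> (forall z, U z -> eps <= `|g - z|) ->
  exists x, [/\ W x, `|x| = 1 & forall z, U z -> 2^-1 <= `|x - z|].
Proof.
move=> [U0 Ulin] [W0 Wlin] UW Wg eps_gt0 far.
have [z Uz zP] := almost_nearest _ _ U g eps U0 eps_gt0 far.
set r := `|g - z| in zP.
have r_gt0 : 0 < r by apply: lt_le_trans (far z Uz).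
have r_neq0 : r != 0 by rewrite gt_eqF.
exists (r^-1 *: (g - z)); split.
- rewrite -[X in W X]addr0; apply: (Wlin) => //.
  by rewrite addrC -scaleN1r; apply: Wlin => //; apply: UW.
- by rewrite normrZ gtr0_norm ?invr_gt0 // mulVf.
move=> z' Uz'.
have -> : r^-1 *: (g - z) - z' = r^-1 *: (g - (r *: z' + z)).
  rewrite opprD addrCA [in RHS]scalerDr scalerN scalerA mulVf // scale1r.
  exact: addrC.
rewrite normrZ gtr0_norm ?invr_gt0 // -ler_pdivrMl ?invr_gt0 // invrK mulrC.
by rewrite ler_pdivrMl //; apply: zP; apply: Ulin.
Qed.

(** For [n < m], [S (x n) - S (x m)] is [x n] minus an element of [U n.+1],
    because [I - S] maps [U n] into [U n.+1] and [U m] is contained in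
    [U n.+1].  When [x n] is the unit vector that the Riesz lemma provides in
    [U n], this keeps the vectors [S (x n)] at mutual distance at least 1/2. *)
Lemma no_compact_with_gaps (R : realType) (V : normedModType R[i])
    (S : V -> V) (U : nat -> set V) :
  (forall n, linear_subspace (U n)) ->
  (forall n, U n.+1 `<=` U n) ->
  (forall n x, U n x -> U n.+1 (x - S x)) ->
  (forall n, exists2 g, U n g &
     exists2 eps : R[i], 0 < eps & forall z, U n.+1 z -> eps <= `|g - z|) ->
  exists2 x : nat -> V, bounded_fun x &
    forall s : nat -> nat, increasing_seq s -> ~ cvgn (S \o x \o s).
Proof.
move=> Ulin Udec US gap.
have Umono m n : (n <= m)%N -> U m `<=` U n.
  by move=> /subnK <-; elim: (m - n)%N => [//|k IH] x /Udec /IH.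
have /choice[x xP] n : exists y, [/\ U n y, `|y| = 1 &
    forall z, U n.+1 z -> 2^-1 <= `|y - z|].
  have [g Ug [eps eps_gt0 far]] := gap n.
  by apply: (Riesz _ _ (U n.+1) (U n) g eps).
have separated n m : (n < m)%N -> 2^-1 <= `|S (x n) - S (x m)|.
  move=> nm; have [Ux _ farx] := xP n; have [Ux' _ _] := xP m.
  have -> : S (x n) - S (x m) = x n - (x n - S (x n) + (x m - (x m - S (x m)))).
    by rewrite opprD opprB !subKr addrA addrCA subrr addr0.
  apply: farx; have [_ lin] := Ulin n.+1.
  rewrite -[x n - S (x n)]scale1r; apply: (lin); first exact: US.
  rewrite addrC -scaleN1r; apply: lin; last exact: (Umono m).
  by apply: (Umono m.+1); [exact: ltnW | exact: US].
exists x.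
  exists 1; split=> // M M_gt1 n _ /=; have [_ -> _] := xP n; exact: ltW.
move=> s s_incr /cvgrPdist_lt /(_ 4^-1).
rewrite invr_gt0 ltr0n => /(_ isT)[N _ close].
set l := lim _ in close.
have := separated _ _ (etrans (leqW_mono s_incr N N.+1) (ltnSn N)).
apply/negP; rewrite -real_ltNge ?normr_real //.
have -> : 2^-1 = 4^-1 + 4^-1 :> R[i].
  by rewrite [LHS]splitr -invfM -natrM.
rewrite -(subrK l (S (x (s N)))) -addrA.
apply: (le_lt_trans (ler_normD _ _)); apply: ltrD.
  by rewrite distrC; exact: (close N (leqnn N)).
exact: (close N.+1 (leqnSn N)).
Qed.

(** * Noncompactness of the differentiation operator *)

Theorem corollary2p24 (R : realType) (T : rootedTree) (v : T)
    (two_children : exists w1 w2 : T,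
      [/\ children v w1, children v w2 & w1 <> w2])
    (X : discreteFunctionSpace R T)
    (X_infinite : ~ finite_dimensional X)
    (X_chi : exists2 w : T, children v w & contains X (chi R[i] w)) :
  ~ compact_on X (@tree_deriv T R[i]).
Proof.
case: X_chi => w [w_root wv] [g gE] [S SE S_compact].
have [w' [[w'_root w'v] ww']] : exists w', children v w' /\ w <> w'.
  have [w1 [w2 [c1 c2 w12]]] := two_children.
  have [ww1|] := pselect (w = w1); last by exists w1.
  by exists w2; split=> //; rewrite ww1.
pose A f : X := f - S f.
have evB (f h : X) x : ev X (f - h) x = ev X f x - ev X h x.
  by rewrite -scaleN1r ev_add ev_scale mulN1r.
have ev0 x : ev X 0 x = 0 by rewrite -(subrr 0) evB subrr.
have AE f x : ev X (A f) x = ev X f (if x == root_vertex then x else parent x).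
  by rewrite evB SE /tree_deriv; case: eqP => _; rewrite ?subr0 ?subKr.
have A0 : A 0 = 0 by apply: ev_inj => x; rewrite AE !ev0.
have Alin a f h : A (a *: f + h) = a *: A f + A h.
  by apply: ev_inj => x; rewrite !(ev_add, ev_scale, AE).
have descendant u : u != root_vertex -> forall n, exists y, y != root_vertex /\
    forall f, ev X (iter n A f) y = ev X f u.
  move=> u_root; elim=> [|n [y [y_root yE]]]; first by exists u.
  have [y' [y'_root y'y]] := has_child T w w' y ww'.
  by exists y'; split=> // f; rewrite /= AE (negPf y'_root) y'y.
have [||||x x_bnd no_cvg] :=
  @no_compact_with_gaps R X S (fun n => range (iter n A)).
- move=> n; split; first by exists 0 => //; elim: n => //= n ->.
  move=> a _ _ [f _ <-] [h _ <-]; exists (a *: f + h) => //.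
  by elim: n => //= n ->.
- by move=> n _ [f _ <-]; exists (A f); rewrite // -iterSr.
- by move=> n _ [f _ <-]; exists f.
- move=> n; exists (iter n A g); first by exists g.
  have [y [_ yE]] := descendant w w_root n.
  have [y' [_ y'E]] := descendant w' w'_root n.
  pose phi f : R[i]^o := ev X f y - ev X f y'.
  have phi_cont : continuous phi.
    by move=> f; apply: cvgB; apply: ev_continuous.
  have /cvgrPdist_lt /(_ 1 ltr01) := phi_cont (iter n A g).
  move=> /nbhs_ballP[eps /= eps_gt0 near_phi]; exists eps => // _ [f _ <-].
  rewrite real_leNgt ?normr_real ?gtr0_real //; apply/negP => close.
  (* [phi] is 1 at [iter n A g] and 0 at [iter n.+1 A f]. *)
  have := near_phi (iter n.+1 A f); rewrite -ball_normE /= => /(_ close).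
  rewrite /phi -[A (iter n A f)]/(iter n.+1 A f) !(iterSr _ _ f, yE, y'E) !AE.
  rewrite (negPf w_root) (negPf w'_root).
  rewrite wv w'v subrr gE /chi eqxx eq_sym; move/eqP/negPf: ww' => ->.
  by rewrite !subr0 normr1 ltxx.
- have [s s_incr s_cvg] := S_compact x x_bnd.
  exact: no_cvg s s_incr s_cvg.
Qed.
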